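(* Let $SE(2)=\{\vec v\mapsto A\vec v+\vec b:\ A\in SO(2),\ \vec b\in\mathbb{R}^2\}$ act on $\mathbb{R}^2$, with $2$ colors. Then $\mathrm{ext}_D(\mathbb{R}^2,SE(2))<\infty$.
   Context: Let a group $\Gamma$ act faithfully on a set $X$. A coloring $c:X\to\{R,B\}$ is $\Gamma$-distinguishing if the only $\gamma\in\Gamma$ with $c\circ\gamma=c$ is the identity. For $W\subset X$ whose pointwise stabilizer in $\Gamma$ is trivial, the property $P(W)$ holds if every precoloring $c:X\setminus W\to\{R,B\}$ can be extended to a $\Gamma$-distinguishing coloring $X\to\{R,B\}$. The distinguishing extension number $\mathrm{ext}_D(X,\Gamma)$ is the smallest $m$ such that every $W\subset X$ with $|W|\geq m$ and trivial pointwise stabilizer satisfies $P(W)$ ($\infty$ if none exists). *)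

(* Defs.v *)
From Stdlib Require Import Reals List.
Open Scope R_scope.

Definition pt := (R * R)%type.

(* g is an element of SE(2): v |-> A v + b with A = [[a,-s],[s,a]] in SO(2). *)
Definition is_SE2 (g : pt -> pt) : Prop :=
  exists a s b1 b2 : R, a * a + s * s = 1 /\
    forall x y : R, g (x, y) = (a * x - s * y + b1, s * x + a * y + b2).

Definition is_id (g : pt -> pt) : Prop := forall p, g p = p.

Definition distinguishing (c : pt -> bool) : Prop :=
  forall g, is_SE2 g -> (forall p, c (g p) = c p) -> is_id g.

Definition trivial_pstab (W : pt -> Prop) : Prop :=
  forall g, is_SE2 g -> (forall w, W w -> g w = w) -> is_id g.

(* P(W): every precoloring of X \ W (modelled by c, whose values on W are
   ignored) extends to a distinguishing coloring. *)
Definition P_ext (W : pt -> Prop) : Prop :=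
  forall c : pt -> bool, exists c' : pt -> bool,
    (forall p, ~ W p -> c' p = c p) /\ distinguishing c'.

Definition card_ge (W : pt -> Prop) (m : nat) : Prop :=
  exists l : list pt, NoDup l /\ length l = m /\ forall p, In p l -> W p.

Definition extD_finite : Prop :=
  exists m : nat, forall W : pt -> Prop,
    card_ge W m -> trivial_pstab W -> P_ext W.

(* Main.v *)
(** Points of the plane are complex numbers. Suppose that all colorings obtained
    by recoloring a finite set [W] have a nontrivial symmetry. Two of them that
    differ somewhere cannot both have a translation symmetry, since the
    translations commute and the difference is finite; so after fixing the color
    of one point every symmetry is a rotation. Rotations about the same center
    commute, so recoloring a single point [w] moves the center of symmetry unless
    [w] is that center. The commutator of two rotations with different centers is
    a translation that preserves the coloring up to finitely many points.

    If two independent translations do so, the coloring differs on a finite set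
    [E] from one with all these symmetries exactly. The center of symmetry of [E]
    is the center of its smallest enclosing circle, which is determined by three
    points of [E], and recoloring another point does not move it. If all such
    translations are parallel to [t], the rotations are half-turns with centers
    on one line parallel to [t]. They exchange the points where the coloring
    differs from its limit in the direction [t] with those where it differs from
    its limit in the direction [-t]. Suitable colors of the points of [W] that are
    extremal in the direction [t] fix the extent of both sets, hence the center,
    whatever the colors of the remaining points. *)

Require Import Defs.
From Stdlib Require Import Reals List.
From Stdlib Require Import Compare_dec Lra Lia Classical ClassicalEpsilon.
From Coquelicot Require Import Coquelicot.

Open Scope C_scope.

(** * Colorings up to finite sets, rotations and limits *)

Definition aeq (c1 c2 : C -> bool) : Prop :=
  exists L : list C, forall x, ~ In x L -> c1 x = c2 x.

Definition rot (p r z : C) : C := p + r * (z - p).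

Definition norm2 (z : C) : R := (fst z * fst z + snd z * snd z)%R.

Definition dot (z w : C) : R := (fst z * fst w + snd z * snd w)%R.

Definition wedge (z w : C) : R := (fst z * snd w - snd z * fst w)%R.

Definition flip (c : C -> bool) (w x : C) : bool :=
  if Ceq_dec x w then negb (c x) else c x.

(** The threshold [N] depends on [x]: the limit along [t] is pointwise, not uniform. *)
Definition shift_limit (c : C -> bool) (t : C) (cl : C -> bool) : Prop :=
  forall x, exists N, forall n, (N <= n)%nat -> c (x + INR n * t) = cl x.

(** What a failure of extension leaves once translation symmetries are excluded; the aim is to
    refute it. *)
Definition all_rotational (c : C -> bool) (W : list C) : Prop :=
  forall c', (forall x, ~ In x W -> c' x = c x) ->
    exists p r, norm2 r = 1%R /\ r <> 1 /\ forall x, c' (rot p r x) = c' x.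

(** * Finite lists *)

Lemma injective_eventually_avoids {A : Type} (f : nat -> A) (L : list A) :
  (forall m n, f m = f n -> m = n) ->
  exists N, forall n, (N <= n)%nat -> ~ In (f n) L.
Proof.
  intros Hf; induction L as [|y L [N HN]].
  - exists 0%nat; intros n _ [].
  - destruct (classic (exists k, f k = y)) as [[k Hk]|Hk].
    + exists (Nat.max N (S k)); intros n Hn [E|E].
      * rewrite <- Hk in E; apply Hf in E; lia.
      * apply (HN n); [lia|exact E].
    + exists N; intros n Hn [E|E].
      * apply Hk; exists n; auto.
      * apply (HN n); auto.
Qed.

Lemma uniform_threshold {A : Type} (Q : A -> nat -> Prop) (L : list A) :
  (forall y, exists N, forall n, (N <= n)%nat -> Q y n) ->
  exists N, forall y, In y L -> forall n, (N <= n)%nat -> Q y n.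
Proof.
  intros H; induction L as [|y L [N HN]].
  - exists 0%nat; intros y [].
  - destruct (H y) as [M HM]; exists (Nat.max N M).
    intros z [<-|Hz] n Hn; [apply HM; lia|apply HN; auto; lia].
Qed.

Lemma exists_outside {A : Type} (W L : list A) :
  NoDup W -> (length L < length W)%nat -> exists w, In w W /\ ~ In w L.
Proof.
  intros HW HL; apply NNPP; intros H.
  assert (incl W L) as HI.
  { intros w Hw; apply NNPP; intros Hn; apply H; exists w; auto. }
  pose proof (NoDup_incl_length HW HI); lia.
Qed.

Lemma upper_bound_on_list {A : Type} (f : A -> R) (L : list A) :
  exists M : R, forall y, In y L -> (f y <= M)%R.
Proof.
  induction L as [|a L [M HM]]; [exists 0%R; intros y []|].
  exists (Rmax M (f a)); intros y [<-|Hy]; [apply Rmax_r|].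
  apply Rle_trans with M; [auto|apply Rmax_l].
Qed.

(** Induction with [E] varying: if some point of [E] beats the head of the list, the search
    continues among those that do, which lie in the tail. *)
Lemma exists_argmax {A : Type} (f : A -> R) (E : A -> Prop) (L : list A) :
  (forall x, E x -> In x L) -> (exists x, E x) ->
  exists x, E x /\ forall y, E y -> (f y <= f x)%R.
Proof.
  revert E; induction L as [|a L IH]; intros E HE [x0 Hx0].
  { destruct (HE x0 Hx0). }
  destruct (classic (exists x, E x /\ (f a < f x)%R)) as [[x1 [Hx1 Hl]]|Hn].
  - destruct (IH (fun x => E x /\ (f a < f x)%R)) as [x [[Hx Hfx] Hm]].
    + intros x [Hx Hfx]; destruct (HE x Hx) as [->|]; auto; lra.
    + exists x1; auto.
    + exists x; split; auto; intros y Hy.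
      destruct (Rlt_dec (f a) (f y)); [apply Hm; auto|lra].
  - assert (forall y, E y -> (f y <= f a)%R) as Ha.
    { intros y Hy; apply Rnot_lt_le; intros Hl; apply Hn; exists y; auto. }
    destruct (classic (E a)) as [HEa|HEa]; [exists a; auto|].
    apply IH; [|exists x0; auto].
    intros x Hx; destruct (HE x Hx) as [->|]; auto; contradiction.
Qed.

(** * Almost equal colorings *)

Implicit Types p q r s t x y z w : C.

Lemma aeq_sym c1 c2 : aeq c1 c2 -> aeq c2 c1.
Proof. intros [L H]; exists L; intros x Hx; symmetry; auto. Qed.

Lemma aeq_trans c1 c2 c3 : aeq c1 c2 -> aeq c2 c3 -> aeq c1 c3.
Proof.
  intros [L H] [L' H']; exists (L ++ L'); intros x Hx.
  rewrite in_app_iff in Hx; rewrite H, H'; tauto.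
Qed.

Lemma aeq_ext c1 c2 : (forall x, c1 x = c2 x) -> aeq c1 c2.
Proof. intros H; exists nil; auto. Qed.

Lemma aeq_comp (g g' : C -> C) c1 c2 :
  (forall x, g' (g x) = x) -> aeq c1 c2 ->
  aeq (fun x => c1 (g x)) (fun x => c2 (g x)).
Proof.
  intros Hg [L H]; exists (map g' L); intros x Hx; apply H; intros Hi.
  apply Hx; rewrite <- (Hg x); apply in_map; exact Hi.
Qed.

Lemma norm2_neq_0 r : norm2 r = 1%R -> r <> 0.
Proof. intros H ->; unfold norm2 in H; simpl in H; lra. Qed.

Lemma rot_inv_l p r x : r <> 0 -> rot p (/ r) (rot p r x) = x.
Proof. intros H; unfold rot; field; exact H. Qed.

Lemma rot_inv_r p r x : r <> 0 -> rot p r (rot p (/ r) x) = x.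
Proof. intros H; unfold rot; field; exact H. Qed.

Lemma aeq_cancel (h h' : C -> C) c1 c2 :
  (forall x, h' (h x) = x) -> (forall x, h (h' x) = x) ->
  aeq (fun x => c1 (h x)) (fun x => c2 (h x)) -> aeq c1 c2.
Proof.
  intros H1 H2 H.
  destruct (aeq_comp h' h _ _ H2 H) as [L HL]; exists L.
  intros x Hx; specialize (HL x Hx); simpl in HL; rewrite H2 in HL; exact HL.
Qed.

(** [rot p r (x + t)] equals [rot p r x + r * t], so conjugation by the rotation turns the vector
    [t] by [r]. *)
Lemma aeq_conjugate_shift c p r t :
  r <> 0 ->
  aeq (fun x => c (rot p r x)) c -> aeq (fun x => c (x + t)) c ->
  aeq (fun x => c (x + r * t)) c.
Proof.
  intros Hr Hg Ht.
  apply (aeq_cancel (rot p r) (rot p (/ r)));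
    [intros; apply rot_inv_l; auto|intros; apply rot_inv_r; auto|].
  apply aeq_trans with (fun x => c (rot p r (x + t))).
  { apply aeq_ext; intros x; f_equal; unfold rot; ring. }
  apply aeq_trans with (fun x => c (x + t)).
  { apply (aeq_comp (fun x => x + t) (fun x => x - t) _ _) in Hg; auto.
    intros; ring. }
  apply aeq_trans with c; auto using aeq_sym.
Qed.

(* The translation below is the commutator of the two rotations. *)
Lemma aeq_commutator_shift c p r q s :
  r <> 0 -> s <> 0 ->
  aeq (fun x => c (rot p r x)) c -> aeq (fun x => c (rot q s x)) c ->
  aeq (fun x => c (x + (1 - r) * (1 - s) * (p - q))) c.
Proof.
  intros Hr Hs Hg Hh.
  assert (forall p r q s, r <> 0 -> aeq (fun x => c (rot p r x)) c ->
    aeq (fun x => c (rot q s x)) c -> aeq (fun x => c (rot q s (rot p r x))) c)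
    as Hc.
  { clear; intros p r q s Hr Hg Hh; apply aeq_trans with (2 := Hg).
    apply (aeq_comp (rot p r) (rot p (/ r))) in Hh; auto.
    intros; apply rot_inv_l; auto. }
  apply (aeq_cancel (fun x => rot q s (rot p r x))
                    (fun x => rot p (/ r) (rot q (/ s) x))).
  - intros x; rewrite rot_inv_l by auto; apply rot_inv_l; auto.
  - intros x; rewrite rot_inv_r by auto; apply rot_inv_r; auto.
  (* The two orders of composition differ by exactly the translation in question. *)
  - apply aeq_trans with (fun x => c (rot p r (rot q s x))).
    { apply aeq_ext; intros x; f_equal; unfold rot; ring. }
    apply aeq_trans with c; [|apply aeq_sym]; apply Hc; auto.
Qed.

(** * Translations *)

Lemma INR_mult_inj (x t : C) m n :
  t <> 0 -> x + INR m * t = x + INR n * t -> m = n.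
Proof.
  intros Ht H.
  assert (RtoC (INR m) = RtoC (INR n)) as E.
  { replace (RtoC (INR m)) with ((x + INR m * t - x) / t) by (field; auto).
    rewrite H; field; auto. }
  apply RtoC_inj in E; apply INR_eq; exact E.
Qed.

Lemma shift_avoids (x t : C) (L : list C) :
  t <> 0 -> exists N, forall n, (N <= n)%nat -> ~ In (x + INR n * t) L.
Proof.
  intros Ht; apply (injective_eventually_avoids (fun n => x + INR n * t)).
  intros m n; apply INR_mult_inj; exact Ht.
Qed.

Lemma INR_S_shift x t n : x + INR (S n) * t = (x + INR n * t) + t.
Proof. rewrite S_INR, RtoC_plus; ring. Qed.

Lemma constant_along_shift (c : C -> bool) t L x :
  (forall z, ~ In z L -> c (z + t) = c z) ->
  (forall j, ~ In (x + INR j * t) L) -> forall n, c (x + INR n * t) = c x.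
Proof.
  intros HL Hx; induction n as [|n IH].
  - f_equal; simpl; ring.
  - rewrite INR_S_shift, HL; auto.
Qed.

Lemma periodic_shift (c : C -> bool) t n x :
  (forall z, c (z + t) = c z) -> c (x + INR n * t) = c x.
Proof. intros H; apply (constant_along_shift c t nil); auto. Qed.

(** From [x] go [i] steps along [t1], then [n] along [t2], then back along [t1] and [t2]; the
    colorings are exchanged only at corners outside the finite difference. *)
Lemma translation_periods_exclusive c1 c2 t1 t2 :
  t1 <> 0 -> t2 <> 0 -> aeq c1 c2 ->
  (forall x, c1 (x + t1) = c1 x) -> (forall x, c2 (x + t2) = c2 x) ->
  forall x, c1 x = c2 x.
Proof.
  intros Ht1 Ht2 [L HL] H1 H2 x.
  destruct (shift_avoids x t1 L Ht1) as [i Hi]; specialize (Hi i (le_n i)).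
  destruct (shift_avoids x t2 L Ht2) as [j Hj].
  destruct (shift_avoids (x + INR i * t1) t2 L Ht2) as [k Hk].
  set (n := Nat.max j k).
  specialize (Hj n ltac:(lia)); specialize (Hk n ltac:(lia)).
  rewrite <- (periodic_shift c1 t1 i x H1), (HL _ Hi).
  rewrite <- (periodic_shift c2 t2 n _ H2), <- (HL _ Hk).
  replace (x + INR i * t1 + INR n * t2) with (x + INR n * t2 + INR i * t1) by ring.
  rewrite (periodic_shift c1 t1 i _ H1), (HL _ Hj).
  apply periodic_shift; exact H2.
Qed.

Lemma shift_limit_exists c t :
  t <> 0 -> aeq (fun x => c (x + t)) c -> exists cl, shift_limit c t cl.
Proof.
  intros Ht [L HL].
  assert (forall x, exists b, exists N, forall n, (N <= n)%nat ->
            c (x + INR n * t) = b) as H.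
  { intros x; destruct (shift_avoids x t L Ht) as [N HN].
    exists (c (x + INR N * t)), N; intros n Hn.
    induction Hn as [|n Hn IH]; [reflexivity|].
    rewrite INR_S_shift, HL; auto. }
  exists (fun x => proj1_sig (constructive_indefinite_description _ (H x))).
  intros x; exact (proj2_sig (constructive_indefinite_description _ (H x))).
Qed.

Lemma shift_limit_aeq c c' t cl :
  t <> 0 -> aeq c c' -> shift_limit c t cl -> shift_limit c' t cl.
Proof.
  intros Ht [L HL] H x; destruct (H x) as [N HN].
  destruct (shift_avoids x t L Ht) as [M HM]; exists (Nat.max N M).
  intros n Hn; rewrite <- HL by (apply HM; lia); apply HN; lia.
Qed.

Lemma shift_limit_unique c t cl x b :
  shift_limit c t cl ->
  (exists N, forall n, (N <= n)%nat -> c (x + INR n * t) = b) -> cl x = b.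
Proof.
  intros H [N HN]; destruct (H x) as [M HM].
  rewrite <- (HM (Nat.max N M)), (HN (Nat.max N M)); auto; lia.
Qed.

Lemma shift_limit_periodic c t cl x :
  shift_limit c t cl -> cl (x + t) = cl x.
Proof.
  intros H; apply (shift_limit_unique c t cl); auto.
  destruct (H x) as [N HN]; exists N; intros n Hn.
  rewrite <- (HN (S n)) by lia; f_equal; rewrite INR_S_shift; ring.
Qed.

(** A ray that misses [L] has constant color, so its start already has the limit color. *)
Lemma off_limit_on_ray (c : C -> bool) t L cl x :
  (forall z, ~ In z L -> c (z + t) = c z) -> shift_limit c t cl ->
  c x <> cl x -> exists n, In (x + INR n * t) L.
Proof.
  intros HL Hcl Hx; apply NNPP; intros H; apply Hx; symmetry.
  apply (shift_limit_unique c t cl); auto.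
  exists 0%nat; intros n _; apply (constant_along_shift c t L); auto.
  intros j Hj; apply H; exists j; exact Hj.
Qed.

(** * Two independent almost periods *)

(** [wedge t] is constant on each line parallel to [t] and takes distinct values for distinct [n],
    so only finitely many of these lines meet [L]. *)
Lemma line_avoids (x t t' : C) (L : list C) :
  wedge t t' <> 0%R ->
  exists N, forall n, (N <= n)%nat -> forall s : R,
    ~ In (x + INR n * t' + s * t) L.
Proof.
  intros Hw.
  destruct (injective_eventually_avoids
    (fun n => wedge t x + INR n * wedge t t')%R (map (wedge t) L)) as [N HN].
  - intros m n H; apply INR_eq, Rmult_eq_reg_r with (wedge t t'); lra.
  - exists N; intros n Hn s Hi; apply (HN n Hn).
    apply (in_map (wedge t)) in Hi.
    replace (wedge t x + INR n * wedge t t')%R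
      with (wedge t (x + INR n * t' + s * t)); auto.
    unfold wedge; simpl; ring.
Qed.

Lemma wedge_swap t t' : wedge t t' = (- wedge t' t)%R.
Proof. unfold wedge; ring. Qed.

(* Go around the finitely many defects on the line [y + R t]: move off it along
   [t'] far out on one side, cross over, and come back on the other side. *)
Lemma backward_limit_eq c t t' cl y :
  wedge t t' <> 0%R ->
  aeq (fun x => c (x + t)) c -> aeq (fun x => c (x + t')) c ->
  shift_limit c t cl ->
  exists N, forall n, (N <= n)%nat -> c (y - INR n * t) = cl y.
Proof.
  intros Hw [L HL] [L' HL'] Hcl.
  assert (wedge t' t <> 0)%R as Hw' by (rewrite wedge_swap; lra).
  assert (wedge t' (- t) <> 0)%R as Hw''.
  { replace (wedge t' (- t)) with (- wedge t' t)%R; [lra|].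
    unfold wedge; simpl; ring. }
  (* The row at height [k] avoids the defects of [t]; the columns through [y - n t] and [y + m t]
     avoid those of [t']. *)
  destruct (line_avoids y t t' L Hw) as [k Hk].
  destruct (line_avoids y t' (- t) L' Hw'') as [N HN].
  destruct (line_avoids y t' t L' Hw') as [M HM].
  destruct (Hcl y) as [M' HM'].
  specialize (Hk k (le_n k)).
  exists N; intros n Hn.
  set (m := Nat.max M M').
  rewrite <- (HM' m) by lia.
  rewrite <- (constant_along_shift c t' L' (y - INR n * t) HL') with (n := k).
  2:{ intros j Hj; apply (HN n Hn (INR j)).
      replace (y + INR n * - t + INR j * t') with (y - INR n * t + INR j * t');
        auto; ring. }
  rewrite <- (constant_along_shift c t' L' (y + INR m * t) HL') with (n := k).
  2:{ intros j Hj; apply (HM m ltac:(lia) (INR j)); exact Hj. }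
  rewrite <- (constant_along_shift c t L (y - INR n * t + INR k * t') HL)
    with (n := (n + m)%nat).
  2:{ intros j Hj; apply (Hk (- INR n + INR j)%R).
      rewrite RtoC_plus, RtoC_opp.
      replace (y + INR k * t' + (- INR n + INR j) * t)
        with (y - INR n * t + INR k * t' + INR j * t); auto; ring. }
  f_equal; rewrite plus_INR, RtoC_plus; ring.
Qed.

(** A point off the limit lies [n] steps before some [y] in [L]. As the backward limit at [y] is
    also [cl y], such [n] stay below a bound common to all of [L]. *)
Lemma aeq_shift_limit c t t' cl :
  t <> 0 -> wedge t t' <> 0%R ->
  aeq (fun x => c (x + t)) c -> aeq (fun x => c (x + t')) c ->
  shift_limit c t cl -> aeq c cl.
Proof.
  intros Ht Hw Hc Hc' Hcl.
  pose proof Hc as [L HL].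
  destruct (uniform_threshold (fun y n => c (y - INR n * t) = cl y) L) as [N HN].
  { intros y; apply (backward_limit_eq c t t'); auto. }
  exists (flat_map (fun y => map (fun n => y - INR n * t) (seq 0 N)) L).
  intros x Hx; apply NNPP; intros Hne.
  destruct (off_limit_on_ray c t L cl x HL Hcl Hne) as [n Hn].
  assert (x = (x + INR n * t) - INR n * t) as Ex by ring.
  destruct (le_lt_dec N n) as [Hl|Hl].
  - apply Hne; rewrite Ex at 1; rewrite (HN _ Hn n Hl).
    apply periodic_shift; intros z; apply (shift_limit_periodic c); auto.
  - apply Hx; apply in_flat_map; exists (x + INR n * t); split; auto.
    apply in_map_iff; exists n; split; [symmetry; exact Ex|].
    apply in_seq; lia.
Qed.

Lemma periodic_aeq_eq u v t :
  t <> 0 -> (forall x, u (x + t) = u x) -> (forall x, v (x + t) = v x) ->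
  aeq u v -> forall x, u x = v x.
Proof.
  intros Ht Hu Hv H; apply (translation_periods_exclusive u v t t); auto.
Qed.

(** An almost symmetry of [c] is one of [cl], and almost equality of two [t]-periodic colorings is
    equality. Periodicity of [cl] under [r * t] makes the rotated coloring [t]-periodic. *)
Lemma shift_limit_rot_invariant c t t' cl p r :
  t <> 0 -> wedge t t' <> 0%R ->
  aeq (fun x => c (x + t)) c -> aeq (fun x => c (x + t')) c ->
  shift_limit c t cl -> r <> 0 -> aeq (fun x => c (rot p r x)) c ->
  forall x, cl (rot p r x) = cl x.
Proof.
  intros Ht Hw Hc Hc' Hcl Hr Hg.
  assert (aeq c cl) as Ha by (apply (aeq_shift_limit c t t'); auto).
  assert (forall x, cl (x + t) = cl x) as Hp.
  { intros x; apply (shift_limit_periodic c); auto. }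
  assert (forall x, cl (x + r * t) = cl x) as Hrt.
  { apply (periodic_aeq_eq (fun x => cl (x + r * t)) cl t); auto.
    - intros x; rewrite <- (Hp (x + r * t)); f_equal; ring.
    - apply aeq_trans with (fun x => c (x + r * t)).
      + apply aeq_sym, (aeq_comp (fun x => x + r * t) (fun x => x - r * t));
          [intros; ring|auto].
      + apply aeq_trans with c; auto.
        apply (aeq_conjugate_shift c p); auto. }
  apply (periodic_aeq_eq (fun x => cl (rot p r x)) cl t); auto.
  - intros x; rewrite <- (Hrt (rot p r x)); f_equal; unfold rot; ring.
  - apply aeq_trans with (fun x => c (rot p r x)).
    + apply aeq_sym, (aeq_comp (rot p r) (rot p (/ r))); auto.
      intros; apply rot_inv_l; auto.
    + apply aeq_trans with c; auto.
Qed.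

(** * Symmetric finite sets and enclosing circles *)

(* Replacing [r] by [r * r] at least doubles [1 - fst r] as long as [0 < fst r]. *)
Lemma obtuse_rotation_dyadic n (E : C -> Prop) p r :
  norm2 r = 1%R -> ((1 / 2) ^ n <= 1 - fst r)%R ->
  (forall x, E x -> E (rot p r x)) ->
  exists r', norm2 r' = 1%R /\ (fst r' <= 0)%R /\
    forall x, E x -> E (rot p r' x).
Proof.
  revert r; induction n as [|n IH]; intros r Hr Hn HE.
  - simpl in Hn; exists r; repeat split; auto; lra.
  - destruct (Rle_dec (fst r) 0) as [Hl|Hl].
    { exists r; repeat split; auto. }
    apply (IH (r * r)).
    + destruct r as [a b]; unfold norm2 in *; simpl in *.
      transitivity ((a * a + b * b) * (a * a + b * b))%R; [ring|].
      rewrite Hr; ring.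
    + destruct r as [a b]; unfold norm2 in *; simpl in *.
      assert (a <= 1)%R by nra.
      nra.
    + intros x Hx; replace (rot p (r * r) x) with (rot p r (rot p r x)); auto.
      unfold rot; ring.
Qed.

Lemma obtuse_rotation (E : C -> Prop) p r :
  norm2 r = 1%R -> r <> 1 -> (forall x, E x -> E (rot p r x)) ->
  exists r', norm2 r' = 1%R /\ (fst r' <= 0)%R /\
    forall x, E x -> E (rot p r' x).
Proof.
  intros Hr H1 HE.
  assert (fst r < 1)%R as Hl.
  { destruct r as [a b]; unfold norm2 in Hr; simpl in *.
    destruct (Rlt_dec a 1) as [|Hn]; auto.
    exfalso; apply H1; unfold RtoC; f_equal; nra. }
  destruct (pow_lt_1_zero (1 / 2)) with (y := (1 - fst r)%R) as [n Hn].
  - rewrite Rabs_pos_eq; lra.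
  - lra.
  - apply (obtuse_rotation_dyadic n E p r); auto.
    specialize (Hn n (le_n n)); rewrite Rabs_pos_eq in Hn; [lra|].
    apply pow_le; lra.
Qed.

(* For [r] of non-positive real part [a], the relation [1 + r^2 = 2 a r] exhibits
   [p] as a convex combination of [x], [r x] and [r^2 x]. *)
Lemma rotation_hull_triple (E : C -> Prop) p r x :
  norm2 r = 1%R -> r <> 1 -> (forall y, E y -> E (rot p r y)) -> E x ->
  exists T : list C, length T = 3%nat /\ (forall y, In y T -> E y) /\
    forall q, exists y, In y T /\
      (norm2 (x - p) + norm2 (p - q) <= norm2 (y - q))%R.
Proof.
  intros Hr H1 HE Hx.
  destruct (obtuse_rotation E p r Hr H1 HE) as [r' [Hr' [Hle HE']]].
  exists (x :: rot p r' x :: rot p r' (rot p r' x) :: nil).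
  split; [reflexivity|split].
  - intros y [<-|[<-|[<-|[]]]]; auto.
  - intros q.
    assert (forall z, norm2 (z - p) = norm2 (x - p) ->
      (0 <= dot (z - p) (p - q))%R ->
      (norm2 (x - p) + norm2 (p - q) <= norm2 (z - q))%R) as Hd.
    { intros z <- Hz; clear -Hz; unfold norm2, dot in *; simpl in *; nra. }
    assert (forall z, norm2 (rot p r' z - p) = norm2 (z - p)) as Hn.
    { intros z; replace (rot p r' z - p) with (r' * (z - p)) by (unfold rot; ring).
      transitivity (norm2 r' * norm2 (z - p))%R; [|rewrite Hr'; ring].
      unfold norm2; simpl; ring. }
    destruct (Rle_dec 0 (dot (x - p) (p - q))) as [|N0].
    { exists x; split; [simpl; auto|apply Hd; auto]. }
    destruct (Rle_dec 0 (dot (rot p r' x - p) (p - q))) as [|N1].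
    { exists (rot p r' x); split; [simpl; auto|apply Hd; auto]. }
    exists (rot p r' (rot p r' x)); split; [simpl; auto|].
    apply Hd; [rewrite !Hn; auto|].
    assert (dot (rot p r' (rot p r' x) - p) (p - q)
            = 2 * fst r' * dot (rot p r' x - p) (p - q) - dot (x - p) (p - q))%R
      as E2.
    { destruct r' as [a b]; unfold norm2 in Hr'; simpl in Hr'.
      destruct x as [x1 x2], p as [p1 p2], q as [q1 q2].
      unfold dot, rot; simpl.
      match goal with |- ?A = ?B => enough (A - B = 0)%R by lra end.
      transitivity ((1 - (a * a + b * b)) *
          ((x1 - p1) * (p1 - q1) + (x2 - p2) * (p2 - q2)))%R; [ring|].
      rewrite Hr'; ring. }
    (* The first two dot products are negative and [fst r'] is not positive, so both terms are
       nonnegative. *)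
    rewrite E2; nra.
Qed.

Lemma norm2_pos t : t <> 0 -> (0 < norm2 t)%R.
Proof.
  intros Ht; destruct t as [a b]; unfold norm2; simpl.
  destruct (Req_dec a 0) as [->|]; [|nra].
  destruct (Req_dec b 0) as [->|]; [|nra].
  exfalso; apply Ht; reflexivity.
Qed.

Lemma Csub_neq_0 p q : p <> q -> p - q <> 0.
Proof.
  intros H E; apply H; replace p with (p - q + q) by ring; rewrite E; ring.
Qed.

Lemma norm2_sub_eq p q : (norm2 (p - q) <= 0)%R -> p = q.
Proof.
  intros H; destruct (Ceq_dec p q) as [|Hn]; auto.
  pose proof (norm2_pos _ (Csub_neq_0 p q Hn)); lra.
Qed.

(* The center of symmetry of a bounded set is the center of its smallest
   enclosing circle, so it cannot move when the triple of
   [rotation_hull_triple] is kept. *)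
Lemma enclosing_circle_center (E : C -> Prop) (L : list C) p r :
  (forall x, E x -> In x L) -> (exists x, E x) ->
  norm2 r = 1%R -> r <> 1 -> (forall x, E x -> E (rot p r x)) ->
  exists T : list C, length T = 3%nat /\ (forall x, In x T -> E x) /\
    forall (E' : C -> Prop) q s,
      norm2 s = 1%R -> s <> 1 -> (forall x, E' x -> E' (rot q s x)) ->
      (forall x, E' x -> E x) -> (forall x, In x T -> E' x) -> p = q.
Proof.
  intros HL Hne Hr Hr1 HE.
  destruct (exists_argmax (fun x => norm2 (x - p)) E L HL Hne) as [x [Hx Hmax]].
  destruct (rotation_hull_triple E p r x Hr Hr1 HE Hx) as [T [HT [HTE Hfar]]].
  exists T; split; [exact HT|split; [exact HTE|]].
  intros E' q s Hs Hs1 HE' Hsub HT'.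
  destruct (Hfar q) as [y [Hy Hyq]].
  destruct (exists_argmax (fun x => norm2 (x - q)) E' L) as [x' [Hx' Hmax']];
    [auto|exists y; auto|].
  destruct (rotation_hull_triple E' q s x' Hs Hs1 HE' Hx')
    as [T' [_ [HTE' Hfar']]].
  destruct (Hfar' p) as [y' [Hy' Hyp]].
  (* Each squared radius plus [norm2 (p - q)] is at most the other squared radius; adding the two
     bounds forces [p = q]. *)
  pose proof (Hmax' y (HT' y Hy)) as H1.
  pose proof (Hmax y' (Hsub y' (HTE' y' Hy'))) as H2.
  cbv beta in H1, H2.
  apply norm2_sub_eq; replace (norm2 (q - p)) with (norm2 (p - q)) in Hyp; [lra|].
  unfold norm2; simpl; ring.
Qed.

(** * Recoloring a single point *)

Lemma flip_same c w : flip c w w = negb (c w).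
Proof. unfold flip; destruct (Ceq_dec w w); congruence. Qed.

Lemma flip_other c w x : x <> w -> flip c w x = c x.
Proof. unfold flip; destruct (Ceq_dec x w); congruence. Qed.

Lemma rot_fixed p r x : r <> 1 -> rot p r x = x -> x = p.
Proof.
  intros Hr H; unfold rot in H.
  apply NNPP; intros Hn; apply (Cmult_neq_0 (r - 1) (x - p));
    [apply Csub_neq_0; auto..|].
  replace ((r - 1) * (x - p)) with (p + r * (x - p) - x) by ring.
  rewrite H; ring.
Qed.

(** With a common center the rotations commute. Following the colors around [w], [rot p r w],
    [rot p s (rot p r w)], [rot p s w] then shows that the flip did not change the color of [w],
    which is absurd. *)
Lemma flip_moves_center c w p q r s :
  r <> 1 -> s <> 1 -> w <> p ->
  (forall x, c (rot p r x) = c x) ->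
  (forall x, flip c w (rot q s x) = flip c w x) -> p <> q.
Proof.
  intros Hr Hs Hw Hc Hf <-.
  assert (forall u : C, u <> 1 -> rot p u w <> w) as Hm.
  { intros u Hu E; exact (Hw (rot_fixed p u w Hu E)). }
  assert (flip c w w = c w) as E; [|rewrite flip_same in E; destruct (c w); discriminate].
  rewrite <- (Hc w), <- (flip_other c w (rot p r w)) by auto.
  rewrite <- (Hf (rot p r w)).
  (* The walk may already be back at [w] here. *)
  destruct (Ceq_dec (rot p s (rot p r w)) w) as [->|Hne]; [reflexivity|].
  rewrite (flip_other c w (rot p s (rot p r w))) by auto.
  replace (rot p s (rot p r w)) with (rot p r (rot p s w)) by (unfold rot; ring).
  rewrite Hc, <- (flip_other c w (rot p s w)) by auto.
  symmetry; apply Hf.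
Qed.

(** Symmetries of different recolorings thus become almost symmetries of one coloring, where they
    can be composed. *)
Lemma aeq_symmetry c c' (g g' : C -> C) :
  (forall x, g' (g x) = x) -> aeq c' c -> (forall x, c' (g x) = c' x) ->
  aeq (fun x => c (g x)) c.
Proof.
  intros Hg Ha Hs; apply aeq_trans with (fun x => c' (g x)).
  - apply aeq_sym, (aeq_comp g g'); auto.
  - apply aeq_trans with c'; auto; apply aeq_ext; auto.
Qed.

Lemma aeq_rot_symmetry c c' p r :
  norm2 r = 1%R -> aeq c' c -> (forall x, c' (rot p r x) = c' x) ->
  aeq (fun x => c (rot p r x)) c.
Proof.
  intros Hr; apply (aeq_symmetry c c' (rot p r) (rot p (/ r))).
  intros x; apply rot_inv_l, norm2_neq_0, Hr.
Qed.

Lemma independent_periods_impossible c W t t' :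
  NoDup W -> (5 <= length W)%nat -> all_rotational c W ->
  t <> 0 -> wedge t t' <> 0%R ->
  aeq (fun x => c (x + t)) c -> aeq (fun x => c (x + t')) c -> False.
Proof.
  intros HW Hlen Hrot Ht Hw Hc Hc'.
  destruct (shift_limit_exists c t Ht Hc) as [cl Hcl].
  assert (forall p r, norm2 r = 1%R -> aeq (fun x => c (rot p r x)) c ->
            forall x, cl (rot p r x) = cl x) as Hinv.
  { intros p r Hr; apply (shift_limit_rot_invariant c t t'); auto.
    apply norm2_neq_0, Hr. }
  (* All of [W] is made to differ from the limit, so that a flip only removes a point from the
     difference set. *)
  set (c1 := fun x => if in_dec Ceq_dec x W then negb (cl x) else c x).
  assert (forall x, ~ In x W -> c1 x = c x) as H1.
  { intros x Hx; unfold c1; destruct (in_dec Ceq_dec x W); tauto. }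
  assert (forall x, In x W -> c1 x = negb (cl x)) as H1'.
  { intros x Hx; unfold c1; destruct (in_dec Ceq_dec x W); tauto. }
  assert (aeq c1 c) as Ha1 by (exists W; auto).
  assert (aeq c1 cl) as [L HL].
  { apply aeq_trans with c; auto; apply (aeq_shift_limit c t t'); auto. }
  destruct (Hrot c1 H1) as [p [r [Hr [Hr1 Hp]]]].
  pose proof (Hinv p r Hr (aeq_rot_symmetry c c1 p r Hr Ha1 Hp)) as Hclp.
  destruct (exists_outside W nil HW) as [w0 [Hw0 _]]; [simpl; lia|].
  destruct (enclosing_circle_center (fun x => c1 x <> cl x) L p r)
    as [T [HT [HTE Hcen]]]; auto.
  { intros x Hx; apply NNPP; intros Hn; apply Hx, HL; auto. }
  { exists w0; rewrite H1' by auto; destruct (cl w0); discriminate. }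
  { intros x; rewrite Hp, Hclp; auto. }
  (* Five points are used here: one besides [p] and the three points of [T]. *)
  destruct (exists_outside W (p :: T) HW) as [w [Hw1 Hw2]]; [simpl; lia|].
  assert (forall x, ~ In x W -> flip c1 w x = c x) as H2.
  { intros x Hx; rewrite flip_other; auto; intros ->; auto. }
  destruct (Hrot (flip c1 w) H2) as [q [s [Hs [Hs1 Hq]]]].
  assert (aeq (flip c1 w) c) as Ha2 by (exists W; auto).
  pose proof (Hinv q s Hs (aeq_rot_symmetry c _ q s Hs Ha2 Hq)) as Hclq.
  apply (flip_moves_center c1 w p q r s); auto.
  { intros ->; apply Hw2; left; auto. }
  apply (Hcen (fun x => flip c1 w x <> cl x) q s); auto.
  - intros x; rewrite Hq, Hclq; auto.
  - intros x Hx; destruct (Ceq_dec x w) as [->|Hne].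
    + rewrite H1' by auto; destruct (cl w); discriminate.
    + rewrite flip_other in Hx; auto.
  - intros x Hx; rewrite flip_other; auto; intros ->; apply Hw2; right; auto.
Qed.

(** * Parallel almost periods *)

Lemma unbounded_climb (X : R -> Prop) (M d x0 : R) :
  (0 < d)%R -> X x0 -> (forall x : R, X x -> (x <= M)%R) ->
  (forall x : R, X x -> exists y : R, X y /\ (x + d <= y)%R) -> False.
Proof.
  intros Hd Hx0 HM Hstep.
  assert (forall n, exists y : R, X y /\ (x0 + INR n * d <= y)%R) as H.
  { induction n as [|n [y [Hy Hle]]].
    - exists x0; split; auto; simpl; lra.
    - destruct (Hstep y Hy) as [z [Hz Hyz]]; exists z; split; auto.
      rewrite S_INR; lra. }
  destruct (INR_unbounded ((M - x0) / d)) as [n Hn].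
  destruct (H n) as [y [Hy Hle]]; specialize (HM y Hy).
  apply (Rmult_lt_compat_r d) in Hn; [|exact Hd].
  unfold Rdiv in Hn; rewrite Rmult_assoc, Rinv_l, Rmult_1_r in Hn; lra.
Qed.

Lemma dot_half_turn t p x :
  dot t (rot p (- (1)) x) = (2 * dot t p - dot t x)%R.
Proof. unfold dot, rot; simpl; ring. Qed.

(* [A] and [B] are swapped by the half-turn about [p], and [A'] and [B'] by the
   one about [q]; the two half-turns in turn move [A] up by [2 t.(p - q)]. *)
Lemma extremal_centers_le (A B A' B' : C -> Prop) t p q (M : R) x0 :
  (forall x, B x -> A (rot p (- (1)) x)) ->
  (forall x, A' x -> B' (rot q (- (1)) x)) ->
  (forall x, A x -> exists y, A' y /\ (dot t x <= dot t y)%R) ->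
  (forall x, B' x -> exists y, B y /\ (dot t y <= dot t x)%R) ->
  (forall x, A x -> (dot t x <= M)%R) -> A x0 ->
  (dot t p <= dot t q)%R.
Proof.
  intros HBA HAB HA HB HM Hx0; apply Rnot_lt_le; intros Hlt.
  apply (unbounded_climb (fun a => exists x, A x /\ dot t x = a) M
           (2 * (dot t p - dot t q)) (dot t x0)); [lra|exists x0; auto| |].
  - intros a [x [Hx <-]]; auto.
  - intros a [x [Hx <-]].
    destruct (HA x Hx) as [y [Hy Hxy]].
    destruct (HB _ (HAB y Hy)) as [z [Hz Hyz]].
    exists (dot t (rot p (- (1)) z)); split; [exists (rot p (- (1)) z); auto|].
    rewrite dot_half_turn in *; lra.
Qed.

Lemma off_limit_bounded c t cl :
  aeq (fun x => c (x + t)) c -> shift_limit c t cl ->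
  exists M : R, forall x, c x <> cl x -> (dot t x <= M)%R.
Proof.
  intros [L HL] Hcl; destruct (upper_bound_on_list (dot t) L) as [M HM].
  exists M; intros x Hx.
  destruct (off_limit_on_ray c t L cl x HL Hcl Hx) as [n Hn].
  apply Rle_trans with (2 := HM _ Hn).
  replace (dot t (x + INR n * t)) with (dot t x + INR n * norm2 t)%R
    by (unfold dot, norm2; simpl; ring).
  pose proof (pos_INR n); unfold norm2; nra.
Qed.

(** A half-turn reverses the direction [t], so it carries forward rays to backward rays. *)
Lemma half_turn_swaps_limits c t cp cm p :
  shift_limit c t cp -> shift_limit c (- t) cm ->
  (forall x, c (rot p (- (1)) x) = c x) ->
  forall x, cm (rot p (- (1)) x) = cp x.
Proof.
  intros Hp Hm Hc x; apply (shift_limit_unique c (- t) cm); auto.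
  destruct (Hp x) as [N HN]; exists N; intros n Hn.
  rewrite <- (HN n Hn), <- (Hc (x + INR n * t)); f_equal; unfold rot; ring.
Qed.

(** [wedge t (r * t)] is the imaginary part of [r] times [norm2 t], so [r] is real of modulus
    one. *)
Lemma parallel_rotation t r :
  t <> 0 -> norm2 r = 1%R -> r <> 1 -> wedge t (r * t) = 0%R -> r = - (1).
Proof.
  intros Ht Hr H1 Hw; pose proof (norm2_pos t Ht) as Hpos.
  assert (snd r = 0)%R as Hb.
  { replace (wedge t (r * t)) with (snd r * norm2 t)%R in Hw
      by (unfold wedge, norm2; simpl; ring).
    apply Rmult_integral in Hw; destruct Hw; lra. }
  destruct r as [a b]; unfold norm2 in Hr; simpl in *; subst b.
  assert ((a - 1) * (a + 1) = 0)%R as E by lra.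
  apply Rmult_integral in E; destruct E as [E|E].
  - exfalso; apply H1; unfold RtoC; f_equal; lra.
  - unfold RtoC, Copp; simpl; f_equal; lra.
Qed.

(** Lagrange's identity: the squares of [dot t (p - q)] and [wedge t (p - q)] add up to
    [norm2 t * norm2 (p - q)]. *)
Lemma wedge_dot_eq t p q :
  t <> 0 -> wedge t (p - q) = 0%R -> dot t p = dot t q -> p = q.
Proof.
  intros Ht Hw Hd; pose proof (norm2_pos t Ht) as Hpos.
  assert (norm2 (p - q) = 0)%R as H.
  { assert (norm2 t * norm2 (p - q) = 0)%R as E.
    { transitivity ((dot t p - dot t q) * (dot t p - dot t q)
                    + wedge t (p - q) * wedge t (p - q))%R.
      - unfold norm2, dot, wedge; simpl; ring.
      - rewrite Hw, Hd; ring. }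
    apply Rmult_integral in E; destruct E; lra. }
  apply norm2_sub_eq; lra.
Qed.

Lemma parallel_periods_impossible c W t :
  NoDup W -> (4 <= length W)%nat -> all_rotational c W -> t <> 0 ->
  aeq (fun x => c (x + t)) c ->
  (forall t', aeq (fun x => c (x + t')) c -> wedge t t' = 0%R) -> False.
Proof.
  intros HW Hlen Hrot Ht Hc Hpar.
  assert (- t <> 0) as Hmt.
  { intros E; apply Ht; replace t with (- - t) by ring; rewrite E; ring. }
  assert (aeq (fun x => c (x + - t)) c) as Hc'.
  { apply aeq_sym.
    apply aeq_trans with (fun x => c (x + - t + t)).
    - apply aeq_ext; intros x; f_equal; ring.
    - apply (aeq_comp (fun x => x + - t) (fun x => x + t) (fun x => c (x + t)));
        auto; intros; ring. }
  destruct (shift_limit_exists c t Ht Hc) as [cp Hcp].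
  destruct (shift_limit_exists c (- t) Hmt Hc') as [cm Hcm].
  assert (forall c', (forall x, ~ In x W -> c' x = c x) -> exists p,
    (forall x, c' (rot p (- (1)) x) = c' x) /\
    (forall x, cm (rot p (- (1)) x) = cp x) /\
    (forall x, cp (rot p (- (1)) x) = cm x) /\
    aeq (fun x => c (rot p (- (1)) x)) c /\
    exists M, forall x, c' x <> cp x -> (dot t x <= M)%R) as Hhalf.
  { intros c' H'; assert (aeq c' c) as Ha by (exists W; auto).
    destruct (Hrot c' H') as [p [r [Hr [Hr1 Hp]]]].
    pose proof (aeq_rot_symmetry c c' p r Hr Ha Hp) as Hcr.
    (* [r * t] is an almost period too, hence parallel to [t]. *)
    assert (r = - (1)) as ->.
    { apply (parallel_rotation t); auto; apply Hpar.
      apply (aeq_conjugate_shift c p); auto; apply norm2_neq_0, Hr. }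
    pose proof (shift_limit_aeq c c' t cp Ht (aeq_sym _ _ Ha) Hcp) as Hcp'.
    pose proof (shift_limit_aeq c c' (- t) cm Hmt (aeq_sym _ _ Ha) Hcm) as Hcm'.
    exists p; split; [exact Hp|split; [|split; [|split; [exact Hcr|]]]].
    - apply (half_turn_swaps_limits c' t); auto.
    - apply (half_turn_swaps_limits c' (- t)); auto.
      replace (- - t) with t by ring; auto.
    - apply (off_limit_bounded c' t); auto.
      apply aeq_trans with (fun x => c (x + t)).
      + apply (aeq_comp (fun x => x + t) (fun x => x - t)); auto; intros; ring.
      + apply aeq_trans with c; auto using aeq_sym. }
  destruct (exists_argmax (dot t) (fun x => In x W) W) as [w1 [Hw1 Hmax]]; auto.
  { destruct (exists_outside W nil HW) as [w [Hw _]]; [simpl; lia|].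
    exists w; exact Hw. }
  (* The minimum is taken among points other than [w1], so that [w2] and [w1] differ even if [dot t]
     is constant on [W]. *)
  destruct (exists_argmax (fun x => - dot t x)%R
              (fun x => In x W /\ ~ In x (w1 :: nil)) W)
    as [w2 [[Hw2 Hne] Hmin']]; [tauto|apply exists_outside; simpl; auto; lia|].
  assert (w2 <> w1) as Hw21 by (intros ->; apply Hne; left; auto).
  assert (forall x, In x W -> (dot t w2 <= dot t x)%R) as Hmin.
  { intros x Hx; destruct (Ceq_dec x w1) as [->|Hx1]; [auto|].
    assert (- dot t x <= - dot t w2)%R; [|lra].
    apply Hmin'; split; auto; intros [E|[]]; auto. }
  set (c1 := fun x => if in_dec Ceq_dec x W then
                        if Ceq_dec x w1 then negb (cp x) else negb (cm x)
                      else c x).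
  assert (forall x, ~ In x W -> c1 x = c x) as H1.
  { intros x Hx; unfold c1; destruct (in_dec Ceq_dec x W); tauto. }
  assert (c1 w1 <> cp w1) as Hc1.
  { unfold c1; destruct (in_dec Ceq_dec w1 W); [|tauto].
    destruct (Ceq_dec w1 w1); [|tauto]; destruct (cp w1); discriminate. }
  assert (c1 w2 <> cm w2) as Hc2.
  { unfold c1; destruct (in_dec Ceq_dec w2 W); [|tauto].
    destruct (Ceq_dec w2 w1); [tauto|]; destruct (cm w2); discriminate. }
  clearbody c1.
  destruct (Hhalf c1 H1) as [p [Hp [Hmp [Hpm [Hap [M HM]]]]]].
  destruct (exists_outside W (p :: w1 :: w2 :: nil) HW) as [w [Hw Hwn]];
    [simpl; lia|].
  assert (w <> p /\ w1 <> w /\ w2 <> w) as [Hwp [Hww1 Hww2]].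
  { repeat split; intros E; apply Hwn; simpl; auto. }
  assert (forall x, ~ In x W -> flip c1 w x = c x) as H2.
  { intros x Hx; rewrite flip_other; auto; intros ->; auto. }
  destruct (Hhalf (flip c1 w) H2) as [q [Hq [Hmq [Hqm [Haq [M' HM']]]]]].
  assert (- (1) <> 1) as Hm1.
  { intros E; apply (f_equal fst) in E; simpl in E; lra. }
  assert (- (1) <> 0) as Hm0.
  { intros E; apply (f_equal fst) in E; simpl in E; lra. }
  apply (flip_moves_center c1 w p q (- (1)) (- (1))); auto.
  apply (wedge_dot_eq t); auto.
  (* The commutator of the two half-turns is a translation by [4 * (p - q)], so [p - q] is parallel
     to [t]. *)
  { pose proof (Hpar _ (aeq_commutator_shift c p _ q _ Hm0 Hm0 Hap Haq)) as E.
    replace (wedge t ((1 - - (1)) * (1 - - (1)) * (p - q)))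
      with (4 * wedge t (p - q))%R in E; [lra|].
    unfold wedge; simpl; ring. }
  apply Rle_antisym.
  (* The two colorings differ only at [w]: there [w1], no lower, stands in from above and [w2], no
     higher, from below. *)
  - apply (extremal_centers_le
      (fun x => c1 x <> cp x) (fun x => c1 x <> cm x)
      (fun x => flip c1 w x <> cp x) (fun x => flip c1 w x <> cm x) t p q M w1);
      auto.
    + intros x; rewrite Hp, Hpm; auto.
    + intros x; rewrite Hq, Hmq; auto.
    + intros x Hx; destruct (Ceq_dec x w) as [->|Hxw].
      * exists w1; rewrite flip_other; auto.
      * exists x; rewrite flip_other; auto; split; auto; lra.
    + intros x Hx; destruct (Ceq_dec x w) as [->|Hxw].
      * exists w2; auto.
      * exists x; rewrite flip_other in Hx; auto; split; auto; lra.
  - apply (extremal_centers_le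
      (fun x => flip c1 w x <> cp x) (fun x => flip c1 w x <> cm x)
      (fun x => c1 x <> cp x) (fun x => c1 x <> cm x) t q p M' w1); auto.
    + intros x; rewrite Hq, Hqm; auto.
    + intros x; rewrite Hp, Hmp; auto.
    + intros x Hx; destruct (Ceq_dec x w) as [->|Hxw].
      * exists w1; auto.
      * exists x; rewrite flip_other in Hx; auto; split; auto; lra.
    + intros x Hx; destruct (Ceq_dec x w) as [->|Hxw].
      * exists w2; rewrite flip_other; auto.
      * exists x; rewrite flip_other; auto; split; auto; lra.
    + rewrite flip_other; auto.
Qed.

(** * The extension number *)

Lemma not_all_rotational c W :
  NoDup W -> (5 <= length W)%nat -> ~ all_rotational c W.
Proof.
  intros HW Hlen Hrot.
  destruct (Hrot c) as [p [r [Hr [Hr1 Hp]]]]; [auto|].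
  destruct (exists_outside W (p :: nil) HW) as [w [Hw Hwp]]; [simpl; lia|].
  assert (forall x, ~ In x W -> flip c w x = c x) as Hf.
  { intros x Hx; apply flip_other; intros ->; auto. }
  destruct (Hrot (flip c w) Hf) as [q [s [Hs [Hs1 Hq]]]].
  assert (p <> q) as Hpq.
  { apply (flip_moves_center c w p q r s); auto.
    intros ->; apply Hwp; left; auto. }
  set (t := (1 - r) * (1 - s) * (p - q)).
  assert (aeq (fun x => c (x + t)) c) as Hct.
  { apply aeq_commutator_shift.
    - apply norm2_neq_0, Hr.
    - apply norm2_neq_0, Hs.
    - apply aeq_ext, Hp.
    - apply (aeq_rot_symmetry c (flip c w)); auto; exists W; auto. }
  assert (t <> 0) as Ht.
  { unfold t; apply Cmult_neq_0; [apply Cmult_neq_0|]; apply Csub_neq_0; auto. }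
  destruct (classic (exists t', aeq (fun x => c (x + t')) c /\ wedge t t' <> 0%R))
    as [[t' [Ht' Hw']]|Hpar].
  - apply (independent_periods_impossible c W t t'); auto.
  - apply (parallel_periods_impossible c W t); auto; [lia|].
    intros t' Ht'; apply NNPP; intros Hn; apply Hpar; exists t'; auto.
Qed.

Lemma SE2_translation_or_rotation (g : pt -> pt) :
  is_SE2 g -> ~ is_id g ->
  (exists t, t <> 0 /\ forall x, g x = x + t) \/
  (exists p r, norm2 r = 1%R /\ r <> 1 /\ forall x, g x = rot p r x).
Proof.
  intros [a [s [b1 [b2 [H1 Hg]]]]] Hid.
  assert (forall x : C, g x = (a, s) * x + (b1, b2)) as Hg'.
  { intros [x y]; rewrite Hg; unfold Cmult, Cplus; simpl; f_equal; ring. }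
  set (r := (a, s) : C) in *; set (b := (b1, b2) : C) in *.
  destruct (Ceq_dec r 1) as [Er|Er].
  - left; exists b; split.
    + intros Eb; apply Hid; intros x; change (@eq C (g x) x).
      rewrite Hg', Er, Eb; ring.
    + intros x; change (@eq C (g x) (x + b)); rewrite Hg', Er; ring.
  (* The center is the fixed point of [r * x + b]. *)
  - right; exists (b / (1 - r)), r; split; [exact H1|split; [exact Er|]].
    intros x; change (@eq C (g x) (rot (b / (1 - r)) r x)).
    rewrite Hg'; unfold rot; field.
    apply Csub_neq_0; auto.
Qed.

(* At most one extension has a translation symmetry; it is ruled out by the
   color of one reserved point [w0]. *)
Lemma exists_distinguishing_extension (c : pt -> bool) (W : list pt) :
  NoDup W -> (6 <= length W)%nat ->
  exists c', (forall x, ~ In x W -> c' x = c x) /\ distinguishing c'.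
Proof.
  intros HW Hlen; apply NNPP; intros Hno.
  destruct W as [|w0 W]; [simpl in Hlen; lia|].
  set (per := fun c' : C -> bool => (forall x, ~ In x (w0 :: W) -> c' x = c x) /\
                 exists t, t <> 0 /\ forall x, c' (x + t) = c' x).
  assert (exists c1, (forall x, ~ In x (w0 :: W) -> c1 x = c x) /\
            forall c', per c' -> c' w0 <> c1 w0) as [c1 [H1 Hper]].
  { destruct (classic (exists c', per c')) as [[c2 Hc2]|Hn].
    - pose proof Hc2 as [Hoff2 [t2 [Ht2 Hs2]]].
      (* Every translation-periodic extension equals [c2], so the opposite color at [w0] excludes
         them all. *)
      exists (flip c2 w0); split.
      + intros x Hx; rewrite flip_other; auto; intros ->; apply Hx; left; auto.
      + intros c' [Hoff [t [Ht Hs]]].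
        rewrite (translation_periods_exclusive c' c2 t t2), flip_same; auto.
        * destruct (c2 w0); discriminate.
        * exists (w0 :: W); intros x Hx; rewrite Hoff, Hoff2; auto.
    - exists c; split; auto; intros c' Hc'; exfalso; apply Hn; exists c'; auto. }
  inversion HW as [|? ? Hw0 HW']; subst.
  apply (not_all_rotational c1 W HW'); [exact (le_S_n _ _ Hlen)|].
  intros c' Hc'.
  assert (forall x, ~ In x (w0 :: W) -> c' x = c x) as Hoff.
  { intros x Hx; rewrite Hc', H1; auto; intros Hi; apply Hx; right; auto. }
  assert (exists g, is_SE2 g /\ (forall x, c' (g x) = c' x) /\ ~ is_id g)
    as [g [Hg [Hs Hid]]].
  { apply NNPP; intros Hn; apply Hno; exists c'; split; auto.
    intros g Hg Hs; apply NNPP; intros Hid; apply Hn; exists g; auto. }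
  destruct (SE2_translation_or_rotation g Hg Hid)
    as [[t [Ht Hgt]]|[p [r [Hr [Hr1 Hgr]]]]].
  - exfalso; apply (Hper c').
    + split; auto; exists t; split; auto; intros x; rewrite <- Hgt; auto.
    + apply Hc'; auto.
  - exists p, r; split; auto; split; auto; intros x; rewrite <- Hgr; auto.
Qed.

Theorem theorem3p3 :
  exists m : nat, forall W : pt -> Prop,
    card_ge W m -> trivial_pstab W -> P_ext W.
Proof.
  (* One point is reserved against translations; five serve against rotations. *)
  exists 6%nat; intros W [l [Hl [Hlen Hin]]] _ c.
  destruct (exists_distinguishing_extension c l Hl) as [c' [Hoff Hd]]; [lia|].
  exists c'; split; auto.
Qed.
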